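(* Let $\mathcal T$ be an undirected, edge-weighted, time-scaled tree on $\{1,\dots,n\}$ with edge weights $w_{ij}>0$ and time scales $\epsilon_i>0$. For a graph $\mathcal G$ obtained from $\mathcal T$ by adding edges, write $\hat\Sigma[\mathcal G]:=\hat\Sigma^{\mathcal T}[\mathcal G]$ for the edge consensus system with output $z=x_{\mathcal T}$, with spanning tree $\mathcal T$. Then the following hold. (1) Adding an edge $e\notin\mathcal T$ with weight $W_{\mathcal C}>0$ to $\mathcal T$ gives $$\mathcal H_2^2(\hat\Sigma[\mathcal T\cup e])=\mathcal H_2^2(\hat\Sigma[\mathcal T])-\frac{\sigma_\omega^2}{2\,l_w(\mathcal C)}\sum_{ij\in\mathcal T\cap\mathcal C}w_{ij}^{-2},$$ where $\mathcal C$ is the unique cycle formed by adding $e$ to $\mathcal T$. Furthermore, adding an edge to $\mathcal T$ to form a cycle always decreases the $\mathcal H_2$ norm. (2) Adding edges $e_1,\dots,e_p$ (with positive weights) to $\mathcal T$ such that the cycles $\mathcal C_1,\dots,\mathcal C_p$ they form with $\mathcal T$ are pairwise edge-disjoint gives $$\mathcal H_2^2(\hat\Sigma[\mathcal T\cup\{e_1,\dots,e_p\}])=\mathcal H_2^2(\hat\Sigma[\mathcal T])-\sum_{k=1}^p\left[\frac{\sigma_\omega^2}{2\,l_w(\mathcal C_k)}\sum_{ij\in\mathcal T\cap\mathcal C_k}w_{ij}^{-2}\right].$$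
   Context: The weighted length of a cycle $\mathcal C$ is $l_w(\mathcal C)=\sum_{e\in\mathcal C}w_e^{-1}$ (the sum includes the added edge, with its weight). Edge consensus. For an undirected graph $\mathcal{G}$ on $\{1,\dots,n\}$, $D_{\mathcal G}$ denotes the incidence matrix: the column of edge $ij$ has $1$ in one of the positions $i,j$ and $-1$ in the other (orientation arbitrary) and zeros elsewhere. $W_{\mathcal G}$ is the diagonal matrix of edge weights, and $E=\mathrm{diag}(\epsilon_1,\dots,\epsilon_n)$. For a connected graph $\mathcal G$ and a spanning tree $\mathcal T\subseteq\mathcal G$, $D_{\mathcal G\setminus\mathcal T}$ is the incidence matrix of the edges of $\mathcal G$ not in $\mathcal T$, $T_{\mathcal T}=(D_{\mathcal T}^\top D_{\mathcal T})^{-1}D_{\mathcal T}^\top D_{\mathcal G\setminus\mathcal T}$, $R_{\mathcal G}=[\,I\;\;T_{\mathcal T}\,]$ (with $R_{\mathcal G}=I$ if $\mathcal G=\mathcal T$), columns of $D_{\mathcal G}$ and $W_{\mathcal G}$ being ordered with tree edges first, and $\mathcal L^{\mathcal T}=D_{\mathcal T}^\top E^{-1}D_{\mathcal T}$ is the edge Laplacian. The system $\hat\Sigma^{\mathcal T}[\mathcal G]$ is $$\dot x_{\mathcal T}=-\mathcal L^{\mathcal T}R_{\mathcal G}W_{\mathcal G}R_{\mathcal G}^\top x_{\mathcal T}+D_{\mathcal T}^\top E^{-1}\omega-\mathcal L^{\mathcal T}R_{\mathcal G}v,\qquad z=x_{\mathcal T},$$ with independent zero-mean Gaussian white noises $\omega,v$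 of covariances $\Omega^2$ and $\Gamma^2$, where $\Omega=\sigma_\omega E^{1/2}$, $\Gamma=\sigma_vW_{\mathcal G}^{1/2}$, and $\sigma_\omega,\sigma_v>0$. Its squared $\mathcal H_2$ norm is given by $$\mathcal H_2^2(\hat\Sigma^{\mathcal T}[\mathcal G])=\frac{\sigma_\omega^2}{2}\mathbf{tr}\left[(R_{\mathcal G}W_{\mathcal G}R_{\mathcal G}^\top)^{-1}\right]+\frac{\sigma_v^2}{2}\mathbf{tr}\left[\mathcal L^{\mathcal T}\right].$$ *)

(* Defs.v *)
From HB Require Import structures.
From mathcomp Require Export all_boot all_order all_algebra.
From mathcomp Require Export all_classical all_reals all_analysis.

(* World: MathComp, with MathComp-Analysis for the H2 norm. *)

Set Implicit Arguments.
Unset Strict Implicit.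
Unset Printing Implicit Defensive.

Export Order.TTheory GRing.Theory Num.Theory.
Export numFieldNormedType.Exports.

Local Open Scope ring_scope.

Section Graphs.
Variable n : nat.

(* The vertices 1, ..., n are the elements of 'I_n; an undirected edge ij is
   the two-element set {i, j}, and a graph is identified with its edge set. *)
Definition is_edge (f : {set 'I_n}) : bool := #|f| == 2%N.
Definition is_graph (G : {set {set 'I_n}}) : Prop :=
  forall f, f \in G -> is_edge f.

Definition adj (G : {set {set 'I_n}}) : rel 'I_n :=
  [rel i j | [set i; j]%SET \in G].

Definition connected_graph (G : {set {set 'I_n}}) : Prop :=
  forall i j, connect (adj G) i j.

(* A cycle is the edge set {c1 c2, c2 c3, ..., ck c1} of a cyclic sequence of
   k >= 3 distinct vertices. *)
Definition is_cycle (C : {set {set 'I_n}}) : Prop :=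
  exists c : seq 'I_n, [/\ uniq c, (2 < size c)%N &
    C = [set [set i; next c i] | i in c]%SET].

Definition cycle_in (G C : {set {set 'I_n}}) : Prop :=
  is_cycle C /\ C \subset G.

Definition is_tree (T : {set {set 'I_n}}) : Prop :=
  [/\ is_graph T, connected_graph T & forall C, ~ cycle_in T C].

End Graphs.

Section LinearSystems.
Variable R : realType.

(* exp(t A) = \sum_k t^k A^k / k!, computed entry by entry. *)
Definition expmx (m : nat) (A : 'M[R]_m) (t : R) : 'M[R]_m :=
  \matrix_(i, j) limn (series (fun k => (A ^+ k) i j * t ^+ k / k`!%:R)).

(* The system x' = A x + B u, z = C x, where u is a vector of independent
   white noises of unit intensity. *)
Record lti (m q l : nat) := Lti {
  ltiA : 'M[R]_m;
  ltiB : 'M[R]_(m, q);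
  ltiC : 'M[R]_(l, m) }.

Definition impulse_response (m q l : nat) (S : lti m q l) (t : R) :
    'M[R]_(l, q) :=
  ltiC S *m expmx (ltiA S) t *m ltiB S.

(* The squared H2 norm is the integral of the squared Frobenius norm of the
   impulse response over [0, +oo[; it is +oo when that integral diverges. *)
Definition H2sq (m q l : nat) (S : lti m q l) : \bar R :=
  (\int[@lebesgue_measure R]_(t in [set` `[0%R, +oo[])
    (\tr (impulse_response S t *m (impulse_response S t)^T))%:E)%E.

Definition H2norm (m q l : nat) (S : lti m q l) : \bar R :=
  poweR (H2sq S) 2^-1.

End LinearSystems.

Section EdgeConsensus.
Variables (R : realType) (n : nat).
Variables (o : {set 'I_n} -> 'I_n) (w : {set 'I_n} -> R) (eps : 'I_n -> R).

(* The orientation is given by o: the entry 1 of the column of f is at o f. *)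
Definition incidence (G : {set {set 'I_n}}) : 'M[R]_(n, #|G|) :=
  \matrix_(i < n, j < #|G|) let f : {set 'I_n} := enum_val j in
    if i \in f then (if i == o f then 1 else -1) else 0.

Definition weight_row (G : {set {set 'I_n}}) : 'rV[R]_#|G| :=
  \row_j w (enum_val j).

Definition timescale_mx : 'M[R]_n := diag_mx (\row_i eps i).
Definition timescale_sqrt_mx : 'M[R]_n := diag_mx (\row_i Num.sqrt (eps i)).

Definition edge_laplacian (T : {set {set 'I_n}}) : 'M[R]_#|T| :=
  (incidence T)^T *m invmx timescale_mx *m incidence T.

(* T_T = (D_T^T D_T)^-1 D_T^T D_{G \ T} *)
Definition tree_cotree_mx (T G : {set {set 'I_n}}) :
    'M[R]_(#|T|, #|G :\: T|) :=
  invmx ((incidence T)^T *m incidence T) *m (incidence T)^T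
    *m incidence (G :\: T).

(* When G = T, the right block has no column and R_G is the identity. *)
Definition R_mx (T G : {set {set 'I_n}}) : 'M[R]_(#|T|, #|T| + #|G :\: T|) :=
  row_mx 1%:M (tree_cotree_mx T G).

Definition graph_weight_row (T G : {set {set 'I_n}}) :
    'rV[R]_(#|T| + #|G :\: T|) :=
  row_mx (weight_row T) (weight_row (G :\: T)).

Definition W_mx (T G : {set {set 'I_n}}) : 'M[R]_(#|T| + #|G :\: T|) :=
  diag_mx (graph_weight_row T G).

Definition W_sqrt_mx (T G : {set {set 'I_n}}) : 'M[R]_(#|T| + #|G :\: T|) :=
  diag_mx (map_mx Num.sqrt (graph_weight_row T G)).

Variables (sw sv : R).

Definition Omega_mx : 'M[R]_n := sw *: timescale_sqrt_mx.
Definition Gamma_mx (T G : {set {set 'I_n}}) :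
  'M[R]_(#|T| + #|G :\: T|) := sv *: W_sqrt_mx T G.

(* The noises omega and v have covariances Omega^2 and Gamma^2, hence are
   Omega and Gamma times independent unit-intensity white noises. *)
Definition edge_consensus (T G : {set {set 'I_n}}) :
    lti R #|T| (n + (#|T| + #|G :\: T|)) #|T| :=
  Lti (- (edge_laplacian T *m R_mx T G *m W_mx T G *m (R_mx T G)^T))
      (row_mx ((incidence T)^T *m invmx timescale_mx *m Omega_mx)
              (- (edge_laplacian T *m R_mx T G *m Gamma_mx T G)))
      1%:M.

Definition weighted_length (C : {set {set 'I_n}}) : R :=
  \sum_(f in C) (w f)^-1.

End EdgeConsensus.

(* Main.v *)
Require Import Defs.
From mathcomp Require Import ring lra.

(** Let [D] be the incidence matrix of the tree [T], [L] its edge Laplacian and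
    [M = R W R^T].  The consensus system has [A = - L M] and
    [B B^T = sw^2 L + sv^2 L M L], so [X = (sw^2 M^-1 + sv^2 L) / 2] solves the
    Lyapunov equation [A X + X A^T = - B B^T], and the squared H2 norm is
    [\tr X] ([H2sq_lyapunov], [H2sq_edge_consensus]).  Convergence of the
    integral needs only that [L] and [M] are bounded below by positive multiples
    of the identity, which follows from the injectivity of [D].

    Only [M] depends on the added edges.  The column of an added edge [e] is a
    combination of the tree columns with coefficients [1] or [-1] on the tree
    edges of its cycle and 0 elsewhere ([chord_column_coordinates]); if [x] is
    the vector of these coefficients, [e] adds [w e *: (x *m x^T)] to the diagonal
    matrix [W_T] of the tree weights.  The Sherman-Morrison formula inverts the sum.
    With [u = W_T^-1 x], the entries of [u] are, up to sign, the [(w f)^-1] for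
    [f] on the cycle, and the denominator [(w e)^-1 + x^T W_T^-1 x] of the formula
    is the weighted length of the cycle.  When the cycles are edge-disjoint, the
    vectors [x] have disjoint supports and the corrections add up
    ([invmx_rank_one_updates], [H2sq_tree_with_chords]).  The correction for one
    edge is positive, as a cycle has tree edges, and both squared norms are
    finite; hence the strict decrease.

    On the graph side, every edge of a forest is a bridge, and summing a linear
    dependency of columns over one side of the corresponding cut shows that the
    columns are independent ([forest_columns_independent]).  This gives the
    injectivity of [D], and also the uniqueness of the cycle closed by [e], since
    two such cycles would provide two systems of coordinates for the same
    column. *)

Local Open Scope ring_scope.
Set Implicit Arguments.
Unset Strict Implicit.
Unset Printing Implicit Defensive.

(** * Matrix exponential and Lyapunov equation *)

Section MatrixExponential.
Local Open Scope classical_set_scope.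
Variables (R : realType) (m : nat) (A : 'M[R]_m).

Lemma expr_mx_entry_le (k : nat) (i j : 'I_m) :
  `|(A ^+ k) i j| <= (\sum_a \sum_b `|A a b|) ^+ k.
Proof.
set K := \sum_a _.
have row_le a : \sum_b `|A a b| <= K.
  rewrite /K [leRHS](bigD1 a)//= lerDl sumr_ge0// => c _.
  by apply: sumr_ge0.
elim: k i j => [|k IH] i j.
  by rewrite !expr0 mxE; case: (i == j); rewrite ?normr1 ?normr0.
rewrite !exprS -mulmxE mxE.
apply: le_trans (ler_norm_sum _ _ _) _.
apply: (@le_trans _ _ (\sum_b `|A i b| * K ^+ k)).
  by apply: ler_sum => b _; rewrite normrM ler_wpM2l.
rewrite -mulr_suml ler_wpM2r// exprn_ge0//.
by apply: sumr_ge0 => a _; apply: sumr_ge0.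
Qed.

(** The coefficients of the [N]-th derivative of an entry of [expmx A], as a
    power series in [t].  Carrying [N] along makes one convergence lemma serve
    the series and the two formal derivatives that differentiation under the
    sum asks for. *)
Definition expmx_coef (i j : 'I_m) (N k : nat) : R :=
  (A ^+ (k + N)) i j / k`!%:R.

Lemma expmx_coef_diffs i j N :
  pseries_diffs (expmx_coef i j N) = expmx_coef i j N.+1.
Proof.
apply/funext => k; rewrite /pseries_diffs /expmx_coef addSnnS factS natrM.
by rewrite invfM mulrCA mulVKf.
Qed.

(** The series is dominated by [K ^+ N] times the exponential series of
    [K * `|x|], with [K] the sum of the absolute values of the entries. *)
Lemma is_cvg_expmx_coef i j N (x : R) :
  cvgn (pseries (expmx_coef i j N) x).
Proof.
set K := \sum_a \sum_b `|A a b|.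
have K0 : 0 <= K by apply: sumr_ge0 => a _; apply: sumr_ge0.
apply: normed_cvg.
apply: (@series_le_cvg _ _ (fun k => K ^+ N * exp_coeff (K * `|x|) k)) => //=.
- move=> k; rewrite mulr_ge0 ?exprn_ge0// /exp_coeff /=.
  by rewrite divr_ge0// exprn_ge0// mulr_ge0.
- move=> k; rewrite /expmx_coef /exp_coeff /= !normrM normrX normfV.
  rewrite [X in _ / X * _]ger0_norm//.
  have -> : K ^+ N * ((K * `|x|) ^+ k / k`!%:R) =
            K ^+ (k + N) / k`!%:R * `|x| ^+ k by rewrite exprMn exprD; ring.
  by rewrite ler_wpM2r ?exprn_ge0// ler_wpM2r// expr_mx_entry_le.
- have -> : (fun k => K ^+ N * exp_coeff (K * `|x|) k) =
            K ^+ N *: exp_coeff (K * `|x|) by [].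
  by apply: is_cvg_seriesZ; exact: is_cvg_series_exp_coeff.
Qed.

Lemma expmxE i j (x : R) : expmx A x i j = limn (pseries (expmx_coef i j 0) x).
Proof.
rewrite mxE /pseries; congr (limn (series _)); apply/funext => k.
by rewrite /expmx_coef /= addn0 mulrAC.
Qed.

Lemma expmx_mul_coef i j (x : R) :
  (expmx A x *m A) i j = limn (pseries (expmx_coef i j 1) x).
Proof.
rewrite mxE.
under eq_bigr do rewrite expmxE.
apply/esym/cvg_lim => //.
have -> : pseries (expmx_coef i j 1) x =
   (fun k => \sum_l (pseries (expmx_coef i l 0) x k * A l j)).
  apply/funext => k; rewrite /pseries /series /=.
  under [RHS]eq_bigr do rewrite mulr_suml.
  rewrite exchange_big/=; apply: eq_bigr => q _.
  rewrite /expmx_coef addn1 exprSr -mulmxE mxE !mulr_suml.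
  by apply: eq_bigr => l _; rewrite addn0; ring.
apply: (cvg_big (@add_continuous _)) => l _.
by apply: cvgMr_tmp; exact: is_cvg_expmx_coef.
Qed.

Lemma is_derive_expmx i j (x : R) :
  is_derive x (1 : R) (fun t => expmx A t i j) ((expmx A x *m A) i j).
Proof.
rewrite expmx_mul_coef -expmx_coef_diffs.
under eq_fun do rewrite expmxE.
apply: (@pseries_snd_diffs _ _ (`|x| + 1));
  rewrite ?expmx_coef_diffs; try exact: is_cvg_expmx_coef.
by rewrite [ltRHS]ger0_norm ?addr_ge0// ltrDl.
Qed.

(** Only the term of index 0 survives at [t = 0]; the shift by one isolates
    it, so that the partial sums become constant. *)
Lemma expmx0 : expmx A 0 = 1%:M.
Proof.
apply/matrixP => i j; rewrite expmxE; apply/cvg_lim => //.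
rewrite -(@cvg_shiftS _ (pseries _ _)) /=.
apply: cvg_near_cst; near=> k.
rewrite /pseries /series /= big_nat_recl//= big1 => [|l _].
  by rewrite /expmx_coef addn0 !expr0 fact0 mulr1 divr1 addr0.
by rewrite exprS mul0r mulr0.
Unshelve. all: by end_near. Qed.

End MatrixExponential.

Section MatrixDerivative.
Variable R : realType.

Definition mx_is_derive (p q : nat) (x : R) (U : R -> 'M[R]_(p, q))
    (dU : 'M[R]_(p, q)) : Prop :=
  forall i j, is_derive x (1 : R) (fun t => U t i j) (dU i j).

Lemma mx_is_derive_cst (p q : nat) (x : R) (M : 'M[R]_(p, q)) :
  mx_is_derive x (fun=> M) 0.
Proof. by move=> i j; rewrite mxE; exact: is_derive_cst. Qed.

Lemma mx_is_derive_tr (p q : nat) (x : R) (U : R -> 'M[R]_(p, q)) dU :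
  mx_is_derive x U dU -> mx_is_derive x (fun t => (U t)^T) dU^T.
Proof.
move=> dUx i j; rewrite mxE.
by under eq_fun do rewrite mxE; exact: dUx.
Qed.

Lemma mx_is_derive_mul (p q r : nat) (x : R) (U : R -> 'M[R]_(p, q))
    (V : R -> 'M[R]_(q, r)) dU dV :
  mx_is_derive x U dU -> mx_is_derive x V dV ->
  mx_is_derive x (fun t => U t *m V t) (dU *m V x + U x *m dV).
Proof.
move=> dUx dVx i j.
have -> : (fun t => (U t *m V t) i j) =
    \sum_k ((fun t => U t i k) * (fun t => V t k j)).
  by apply/funext => t; rewrite mxE fct_sumE.
have -> : (dU *m V x + U x *m dV) i j =
    \sum_k (U x i k *: dV k j + V x k j *: dU i k).
  rewrite !mxE -big_split/=; apply: eq_bigr => k _.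
  by rewrite addrC [X in _ + X]mulrC.
by apply: is_derive_sum => k; exact: is_deriveM.
Qed.

Lemma is_derive_mxtrace (p : nat) (x : R) (U : R -> 'M[R]_p) dU :
  mx_is_derive x U dU -> is_derive x (1 : R) (fun t => \tr (U t)) (\tr dU).
Proof.
move=> dUx.
have -> : (fun t => \tr (U t)) = \sum_i (fun t => U t i i).
  by apply/funext => t; rewrite fct_sumE.
by apply: is_derive_sum => i; exact: dUx.
Qed.

End MatrixDerivative.

Section LyapunovH2.
Local Open Scope classical_set_scope.
Variable R : realType.

(** Writes the trace as a sum of quadratic forms, one per row of [G], so that
    an inequality between the quadratic forms of two matrices [X] passes to
    the traces. *)
Lemma mxtrace_quad (l m : nat) (G : 'M[R]_(l, m)) (X : 'M[R]_m) :
  \tr (G *m X *m G^T) = \sum_i (row i G *m X *m (row i G)^T) 0 0.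
Proof.
apply: eq_bigr => i _.
by rewrite -row_mul [LHS]mxE [RHS]mxE; apply: eq_bigr => j _; rewrite !mxE.
Qed.

(** A rate [1 / (1 + c t)] is enough below, and keeps the scalar exponential
    out of the decay argument. *)
Lemma cvg0_linear_rate (c K : R) (F : R -> R) :
  0 < c -> (forall t, 0 <= t -> 0 <= F t) ->
  (forall t, 0 <= t -> F t * (1 + c * t) <= K) ->
  F t @[t --> +oo%R] --> (0 : R).
Proof.
move=> c0 F0 FK.
apply/cvgrPdist_le => e e0; near=> t.
have t0 : 0 <= t by near: t; exact: nbhs_pinfty_ge.
have tK : K / (c * e) <= t by near: t; apply: nbhs_pinfty_ge; rewrite num_real.
rewrite sub0r normrN ger0_norm ?F0//.
have ct : 0 < 1 + c * t by rewrite ltr_pwDl// mulr_ge0// ltW.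
rewrite -(ler_pM2r ct) (le_trans (FK _ t0))//.
rewrite ler_pdivrMr ?mulr_gt0// in tK.
have e0' := ltW e0; lra.
Unshelve. all: by end_near. Qed.

(** The squared norm of the impulse response is [-] the derivative of
    [t |-> \tr (G X G^T)], where [G = C exp(tA)], as soon as [X] solves the
    Lyapunov equation; the integral over the half line is thus the value of
    this function at 0, provided that it vanishes at infinity.  The bound
    [c X <= B B^T] between quadratic forms yields that decay directly, without
    any information on the spectrum of [A]. *)
Lemma H2sq_lyapunov (m q l : nat) (S : lti R m q l) (X : 'M[R]_m) (c : R) :
  ltiA S *m X + X *m (ltiA S)^T = - (ltiB S *m (ltiB S)^T) ->
  (forall v : 'rV_m, 0 <= (v *m X *m v^T) 0 0) ->
  0 < c ->
  (forall v : 'rV_m, c * (v *m X *m v^T) 0 0 <=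
     (v *m (ltiB S *m (ltiB S)^T) *m v^T) 0 0) ->
  H2sq S = (\tr (ltiC S *m X *m (ltiC S)^T))%:E.
Proof.
move=> lyap X0 c0 Xc.
set Q := ltiB S *m (ltiB S)^T in lyap Xc.
pose G t := ltiC S *m expmx (ltiA S) t.
pose quad (Y : 'M[R]_m) t := \tr (G t *m Y *m (G t)^T).
have dG t : mx_is_derive t G (G t *m ltiA S).
  have := mx_is_derive_mul (mx_is_derive_cst t (ltiC S))
    (fun i j => is_derive_expmx (ltiA S) i j t).
  by rewrite mul0mx add0r mulmxA.
have dquad Y t : is_derive t (1 : R) (quad Y)
    (quad (ltiA S *m Y + Y *m (ltiA S)^T) t).
  apply: is_derive_eq (is_derive_mxtrace (mx_is_derive_mul
    (mx_is_derive_mul (dG t) (mx_is_derive_cst t Y)) (mx_is_derive_tr (dG t)))) _.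
  congr (\tr _).
  by rewrite mulmx0 addr0 [(G t *m ltiA S)^T]trmx_mul mulmxDr mulmxDl !mulmxA.
have dX t : is_derive t (1 : R) (quad X) (- quad Q t).
  have := dquad X t; rewrite lyap /quad.
  by rewrite mulmxN mulNmx raddfN.
have cont_quad Y : continuous (quad Y).
  move=> t; apply: differentiable_continuous; apply/derivable1_diffP.
  by case: (dquad Y t).
have quadX_ge0 t : 0 <= quad X t.
  by rewrite /quad mxtrace_quad; apply: sumr_ge0 => i _; exact: X0.
have quad_le t : c * quad X t <= quad Q t.
  rewrite /quad !mxtrace_quad mulr_sumr; apply: ler_sum => i _; exact: Xc.
have quadQ_ge0 t : 0 <= quad Q t.
  by apply: le_trans (quad_le t); rewrite mulr_ge0// ltW.
have decay : quad X t @[t --> +oo%R] --> (0 : R).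
  apply: (@cvg0_linear_rate c (quad X 0)) => // t t0.
  (* h' = c X(s) - (1 + c s) Q(s) <= - c^2 s X(s), because c X <= Q *)
  pose h := fun s : R => quad X s * (1 + c * s).
  have dh s : is_derive s (1 : R) h (quad X s * c - (1 + c * s) * quad Q s).
    have dlin : is_derive s (1 : R) (fun s : R => 1 + c * s) c.
      have -> : (fun s : R => 1 + c * s) = cst 1 + c *: id :> (R -> R) by [].
      by apply: is_derive_eq; rewrite add0r /GRing.scale /= mulr1.
    apply: is_derive_eq (is_deriveM (dX s) dlin) _.
    by rewrite /GRing.scale/= mulrN.
  have -> : quad X 0 = h 0 by rewrite /h mulr0 addr0 mulr1.
  apply: (@ler0_derive1_nincry _ h 0) => //.
  - move=> s; rewrite in_itv/= andbT => s0.
    rewrite derive1E; case: (dh s) => _ ->.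
    have cs : 0 <= c * s by rewrite mulr_ge0 ?ltW.
    have := quad_le s; have := quadX_ge0 s.
    by move=> a b; have := mulr_ge0 cs a; have := ler_wpM2l cs b; nra.
  - apply: continuous_subspaceT => s.
    by apply: differentiable_continuous; apply/derivable1_diffP; case: (dh s).
rewrite /H2sq.
have -> : (fun t => (\tr (impulse_response S t *m (impulse_response S t)^T))%:E)
        = (fun t => (quad Q t)%:E).
  by apply/funext => t; rewrite /impulse_response /quad /G trmx_mul !mulmxA.
rewrite (@ge0_continuous_FTC2y _ (quad Q) (- quad X) 0 0).
- rewrite sub0e opprfctE -EFinN opprK /quad /G expmx0.
  by rewrite mulmx1.
- by move=> t _.
- exact/continuous_subspaceT/cont_quad.
- by rewrite -oppr0; apply: cvgN.
- by move=> t _; apply: derivableN; case: (dX t).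
- by apply: cvg_at_right_filter; apply: cvgN; exact: cont_quad.
- move=> t _; rewrite derive1E deriveN; last by case: (dX t).
  by case: (dX t) => _ ->; rewrite opprK.
Qed.

End LyapunovH2.

(** * Coercive matrices and rank-one updates *)

Lemma unitmx_ker0 (F : fieldType) (m : nat) (A : 'M[F]_m) :
  (forall v : 'rV_m, v *m A = 0 -> v = 0) -> A \in unitmx.
Proof.
move=> A0; rewrite -row_free_unit -kermx_eq0; apply/rowV0P => v.
by move/sub_kermxP/A0.
Qed.

Lemma invmx_uniq (F : fieldType) (m : nat) (A B : 'M[F]_m) :
  A *m B = 1%:M -> invmx A = B.
Proof.
move=> AB; have [Au _] := mulmx1_unit AB.
by rewrite -[LHS]mulmx1 -AB mulKmx.
Qed.

Lemma invmx_diag (F : fieldType) (m : nat) (d : 'rV[F]_m) :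
  (forall i, d 0 i != 0) -> invmx (diag_mx d) = diag_mx (\row_i (d 0 i)^-1).
Proof.
move=> d0; apply: invmx_uniq; rewrite mulmx_diag -diag_const_mx; congr diag_mx.
by apply/rowP => i; rewrite !mxE divff.
Qed.

(** The Sherman-Morrison formula for several updates at once: since the [x k]
    are orthogonal for the form [B = A^-1], the corrections do not interact and
    each contributes its own one-update term. *)
Lemma invmx_rank_one_updates (F : fieldType) (m p : nat) (A B : 'M[F]_m)
    (x : 'I_p -> 'cV[F]_m) (a l : 'I_p -> F) :
  A *m B = 1%:M ->
  (forall j k, j != k -> (x j)^T *m B *m x k = 0) ->
  (forall k, a k != 0) -> (forall k, l k != 0) ->
  (forall k, l k = (a k)^-1 + ((x k)^T *m B *m x k) 0 0) ->
  invmx (A + \sum_k a k *: (x k *m (x k)^T)) =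
  B - \sum_k (l k)^-1 *: (B *m x k *m (x k)^T *m B).
Proof.
move=> AB xBx a0 l0 lE; apply: invmx_uniq.
rewrite mulmxBr mulmxDl AB mulmxDl.
have AS : A *m (\sum_k (l k)^-1 *: (B *m x k *m (x k)^T *m B)) =
    \sum_k (l k)^-1 *: (x k *m (x k)^T *m B).
  rewrite mulmx_sumr; apply: eq_bigr => k _.
  by rewrite -scalemxAr !mulmxA AB mul1mx.
have xBxk k : (x k)^T *m B *m x k = (l k - (a k)^-1)%:M.
  by rewrite [LHS]mx11_scalar lE addrC addKr.
have US : (\sum_j a j *: (x j *m (x j)^T)) *m
    (\sum_k (l k)^-1 *: (B *m x k *m (x k)^T *m B)) =
    \sum_k (a k * (l k - (a k)^-1) / l k) *: (x k *m (x k)^T *m B).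
  rewrite mulmx_suml; apply: eq_bigr => j _.
  rewrite mulmx_sumr (bigD1 j)//= big1 => [|k kj].
    rewrite addr0 -scalemxAl -scalemxAr scalerA.
    have -> : x j *m (x j)^T *m (B *m x j *m (x j)^T *m B) =
        x j *m ((x j)^T *m B *m x j) *m ((x j)^T *m B) by rewrite !mulmxA.
    rewrite xBxk -scalemx1 -scalemxAr mulmx1 -scalemxAl scalerA mulmxA.
    by congr (_ *: _); ring.
  rewrite -scalemxAl -scalemxAr.
  have -> : x j *m (x j)^T *m (B *m x k *m (x k)^T *m B) =
      x j *m ((x j)^T *m B *m x k) *m ((x k)^T *m B) by rewrite !mulmxA.
  by rewrite xBx 1?eq_sym// mulmx0 mul0mx !scaler0.
have UB : (\sum_j a j *: (x j *m (x j)^T)) *m B =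
    \sum_k a k *: (x k *m (x k)^T *m B).
  by rewrite mulmx_suml; apply: eq_bigr => k _; rewrite -scalemxAl.
rewrite AS US UB -big_split/= -addrA -sumrB big1 ?addr0// => k _.
rewrite -scalerDl -scalerBl.
set s := (_ - _); suff -> : s = 0 by rewrite scale0r.
by rewrite /s; field; rewrite a0 l0.
Qed.

Section QuadraticForms.
Variable R : realFieldType.

Lemma sqnormE (m : nat) (v : 'rV[R]_m) : (v *m v^T) 0 0 = \sum_i v 0 i ^+ 2.
Proof. by rewrite mxE; apply: eq_bigr => i _; rewrite mxE expr2. Qed.

Lemma sqnorm_ge0 (m : nat) (v : 'rV[R]_m) : 0 <= (v *m v^T) 0 0.
Proof. by rewrite sqnormE; apply: sumr_ge0 => i _; rewrite sqr_ge0. Qed.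

Lemma sqnorm_eq0 (m : nat) (v : 'rV[R]_m) : (v *m v^T) 0 0 = 0 -> v = 0.
Proof.
rewrite sqnormE => /eqP.
rewrite psumr_eq0 => [/allP v0|i _]; last exact: sqr_ge0.
apply/rowP => i; rewrite mxE; apply/eqP.
by have := v0 i; rewrite mem_index_enum sqrf_eq0 => /(_ isT).
Qed.

Lemma quad_diag (m : nat) (d v : 'rV[R]_m) :
  (v *m diag_mx d *m v^T) 0 0 = \sum_i d 0 i * v 0 i ^+ 2.
Proof.
by rewrite mxE; apply: eq_bigr => i _; rewrite mul_mx_diag !mxE; ring.
Qed.

Lemma quad_comb (m : nat) (a b : R) (P Q : 'M[R]_m) (v : 'rV[R]_m) :
  (v *m (a *: P + b *: Q) *m v^T) 0 0 =
  a * (v *m P *m v^T) 0 0 + b * (v *m Q *m v^T) 0 0.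
Proof.
rewrite mulmxDr mulmxDl -!scalemxAr -!scalemxAl mxE.
by congr (_ + _); rewrite mxE.
Qed.

Lemma quad_upper_bound (m : nat) (X : 'M[R]_m) :
  exists2 K : R, 0 < K &
    forall v : 'rV_m, (v *m X *m v^T) 0 0 <= K * (v *m v^T) 0 0.
Proof.
exists (1 + \sum_i \sum_j `|X i j|).
  by rewrite ltr_pwDl// sumr_ge0// => i _; rewrite sumr_ge0.
move=> v; set N := (v *m v^T) 0 0.
have N0 : 0 <= N := sqnorm_ge0 v.
have vN i : v 0 i ^+ 2 <= N.
  rewrite /N sqnormE (bigD1 i)//= lerDl.
  by apply: sumr_ge0 => k _; exact: sqr_ge0.
have -> : (v *m X *m v^T) 0 0 = \sum_i \sum_j v 0 i * X i j * v 0 j.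
  rewrite exchange_big mxE; apply: eq_bigr => j _.
  by rewrite !mxE mulr_suml.
apply: (@le_trans _ _ ((\sum_i \sum_j `|X i j|) * N)); last first.
  by rewrite ler_wpM2r// lerDr.
rewrite mulr_suml; apply: ler_sum => i _.
rewrite mulr_suml; apply: ler_sum => j _.
have -> : v 0 i * X i j * v 0 j = X i j * (v 0 i * v 0 j) by ring.
apply: le_trans (ler_norm _) _; rewrite normrM ler_wpM2l//.
rewrite ler_norml; have := vN i; have := vN j.
by have := sqr_ge0 (v 0 i + v 0 j); have := sqr_ge0 (v 0 i - v 0 j);
  move=> *; apply/andP; split; nra.
Qed.

Lemma coercive_unitmx (m : nat) (M : 'M[R]_m) (c : R) : 0 < c ->
  (forall v : 'rV_m, c * (v *m v^T) 0 0 <= (v *m M *m v^T) 0 0) ->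
  M \in unitmx.
Proof.
move=> c0 Mc; apply: unitmx_ker0 => v vM; apply: sqnorm_eq0.
apply/eqP; rewrite eq_le sqnorm_ge0 andbT -(pmulr_rle0 _ c0).
by apply: le_trans (Mc v) _; rewrite vM mul0mx mxE.
Qed.

Lemma gram_unitmx (m n : nat) (D : 'M[R]_(n, m)) :
  (forall v : 'rV_m, v *m D^T = 0 -> v = 0) -> D^T *m D \in unitmx.
Proof.
move=> D0; apply: unitmx_ker0 => v vDD; apply/D0/sqnorm_eq0.
by rewrite trmx_mul trmxK mulmxA -(mulmxA v) vDD mul0mx mxE.
Qed.

(** A left inverse [(D^T D)^-1 D^T] of [D] recovers [v] from [D v], hence bounds
    its norm by that of [D v]; this gives an explicit constant and dispenses
    with eigenvalues and compactness. *)
Lemma weighted_gram_coercive (m n : nat) (D : 'M[R]_(n, m)) (d : 'rV[R]_n) :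
  (forall v : 'rV_m, v *m D^T = 0 -> v = 0) -> (forall i, 0 < d 0 i) ->
  exists2 c : R, 0 < c & forall v : 'rV_m,
    c * (v *m v^T) 0 0 <= (v *m (D^T *m diag_mx d *m D) *m v^T) 0 0.
Proof.
move=> D0 d0; have Gu := gram_unitmx D0.
set G := invmx (D^T *m D).
have [K K0 leK] := quad_upper_bound ((D *m G) *m (D *m G)^T).
(* s^-1 bounds every weight d 0 i from below; the 1 keeps s > 0 if n = 0 *)
pose s := 1 + \sum_i (d 0 i)^-1.
have sum_ge0 (P : pred 'I_n) : 0 <= \sum_(i | P i) (d 0 i)^-1.
  by apply: sumr_ge0 => i _; rewrite invr_ge0 ltW.
have s0 : 0 < s by rewrite /s ltr_pwDl.
exists ((K * s)^-1) => [|v]; first by rewrite invr_gt0 mulr_gt0.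
rewrite ler_pdivrMl ?mulr_gt0//.
set y := v *m D^T.
have -> : v *m (D^T *m diag_mx d *m D) *m v^T = y *m diag_mx d *m y^T.
  by rewrite /y trmx_mul trmxK !mulmxA.
have vy : v = y *m (D *m G).
  by rewrite /y !mulmxA -(mulmxA v) mulmxK.
have -> : v *m v^T = y *m ((D *m G) *m (D *m G)^T) *m y^T.
  by rewrite {1 2}vy [(y *m _)^T]trmx_mul !mulmxA.
apply: le_trans (leK y) _; rewrite -mulrA ler_pM2l//.
rewrite sqnormE quad_diag mulr_sumr; apply: ler_sum => i _.
rewrite mulrA ler_peMl ?sqr_ge0//.
rewrite -ler_pdivrMr// mul1r /s (bigD1 i)//= addrCA lerDl.
by rewrite addr_ge0.
Qed.

End QuadraticForms.

(** * Cycles, bridges and incidence columns *)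

Section Cycles.
Variables (n : nat) (c : seq 'I_n).
Hypotheses (Uc : uniq c) (c_gt2 : (2 < size c)%N).

(** The second inequality is what excludes an edge traversed in both directions,
    the degenerate cycle on two vertices. *)
Lemma next_next_neq (i : 'I_n) :
  i \in c -> next c i != i /\ next c (next c i) != i.
Proof.
move=> /rot_to[k s Es].
have Us : uniq (i :: s) by rewrite -Es rot_uniq.
have Ss : (2 < size (i :: s))%N by rewrite -Es size_rot.
rewrite -!(next_rot k Uc) Es.
case: s Us Ss {Es} => [|a [|b s]]//=.
rewrite !inE !negb_or => /andP[/andP[ia /andP[ib _]] _] _.
by rewrite !eqxx [a == i]eq_sym (negPf ia) [b == i]eq_sym (negPf ib).
Qed.

Lemma cycle_edge_inj : {in c &, injective (fun i => [set i; next c i]%SET)}.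
Proof.
move=> i j ic jc /setP E; apply/eqP; apply: contraT => ij.
have := E i; rewrite !inE eqxx (negPf ij) /= => /esym/eqP inj.
have := E j; rewrite !inE eqxx eq_sym (negPf ij) /= => /eqP jni.
by have [_] := next_next_neq ic; rewrite -jni -inj eqxx.
Qed.

End Cycles.

Lemma card_cycle (n : nat) (C : {set {set 'I_n}}) : is_cycle C -> (2 < #|C|)%N.
Proof.
case=> c [Uc c_gt2 ->].
by rewrite card_in_imset ?(card_uniqP Uc)//; exact: cycle_edge_inj.
Qed.

Section Connectivity.
Variable n : nat.
Implicit Types (G T C : {set {set 'I_n}}) (e f : {set 'I_n}).

Lemma adj_sym G : symmetric (adj G).
Proof. by move=> i j; rewrite /adj /= finset.setUC. Qed.

(** A path without repetition from [i] to [j] has at least two edges, as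
    [i] and [j] are distinct and not adjacent in [G]; hence the closed sequence
    has at least three vertices. *)
Lemma path_closes_to_cycle G (i j : 'I_n) :
  i != j -> [set i; j]%SET \notin G -> connect (adj G) i j ->
  exists C, cycle_in ([set i; j] |: G)%SET C.
Proof.
move=> ij ijG /connectP[p' Pp' Ej].
case/shortenP: Pp' Ej => p Pp Up _ Ej {p'}.
pose c := i :: p.
have size_c : (2 < size c)%N.
  rewrite /c; case: p Pp Ej {Up c} => [|a [|b p]]//=.
    by move=> _ ji; rewrite ji eqxx in ij.
  by rewrite andbT => ia aj; rewrite /adj /= -aj (negPf ijG) in ia.
have cyc : cycle (adj ([set i; j] |: G)%SET) c.
  rewrite /= rcons_path -Ej /adj /= [[set j; i]%SET]finset.setUC finset.setU11 andbT.
  by apply: sub_path Pp => a b; rewrite /adj /= finset.in_setU => ->; rewrite orbT.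
exists [set [set k; next c k] | k in c]%SET; split; first by exists c.
apply/fintype.subsetP => _ /imsetP[k kc ->].
exact: next_cycle cyc kc.
Qed.

(** Otherwise a path avoiding the edge would close to a cycle with it. *)
Lemma forest_edge_is_bridge T (i j : 'I_n) :
  (forall C, ~ cycle_in T C) -> i != j -> [set i; j]%SET \in T ->
  ~~ connect (adj (T :\ [set i; j])%SET) i j.
Proof.
move=> acyc ij ijT; apply/negP => conn.
have [|C] := path_closes_to_cycle ij _ conn; first by rewrite finset.setD11.
by rewrite finset.setD1K//; exact: acyc.
Qed.

(** A cycle avoiding the chord would lie in the forest. *)
Lemma chord_in_cycle T C e :
  (forall C, ~ cycle_in T C) -> cycle_in (e |: T)%SET C ->
  C = (e |: (T :&: C))%SET.
Proof.
move=> acyc [cycC /fintype.subsetP CeT].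
have eC : e \in C.
  apply: contraT => eC; case: (acyc C); split=> //.
  apply/fintype.subsetP => f fC; have := CeT f fC.
  by rewrite in_setU1 => /predU1P[fe|//]; rewrite fe (negPf eC) in fC.
apply/setP => f; rewrite !inE.
have [->|fe] := eqVneq f e; first by rewrite eC.
have [fC|] := boolP (f \in C); rewrite ?andbF ?andbT//.
by have := CeT f fC; rewrite in_setU1 (negPf fe).
Qed.

End Connectivity.

Section IncidenceColumns.
Variables (R : realType) (n : nat) (o : {set 'I_n} -> 'I_n).
Hypothesis orientation : forall f : {set 'I_n}, is_edge f -> o f \in f.
Implicit Types (T C : {set {set 'I_n}}) (e f : {set 'I_n}).

Definition edge_column (f : {set 'I_n}) (i : 'I_n) : R :=
  if i \in f then (if i == o f then 1 else -1) else 0.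

Lemma edge_column_ends (i j : 'I_n) : i != j ->
  forall v, edge_column [set i; j]%SET v =
    (if o [set i; j]%SET == i then 1 else -1) * ((v == i)%:R - (v == j)%:R).
Proof.
move=> ij v; have := @orientation [set i; j]%SET.
rewrite /is_edge cards2 ij eqxx => /(_ isT).
rewrite /edge_column !inE; set a := o _ => /orP[]/eqP ->.
  rewrite eqxx mul1r; have [->|vi]/= := eqVneq v i.
    by rewrite (negPf ij) subr0.
  by have [vj|vj]/= := eqVneq v j; rewrite sub0r ?oppr0.
rewrite [j == i]eq_sym (negPf ij).
have [->|vi]/= := eqVneq v i; first by rewrite (negPf ij) subr0 mulr1.
by have [vj|vj]/= := eqVneq v j; rewrite ?mulN1r !sub0r ?opprK ?oppr0.
Qed.

(** Signing each edge of a cycle according to whether its orientation agrees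
    with the direction of travel, the columns telescope around the cycle. *)
Lemma cycle_dependency C : is_cycle C ->
  exists2 y : {set 'I_n} -> R, (forall f, y f ^+ 2 = 1) &
    forall v, \sum_(f in C) y f * edge_column f v = 0.
Proof.
case=> c [Uc c_gt2 ->].
(* y f is 1 when f leaves its positive end o f along the cycle *)
pose y f : R := if f == [set o f; next c (o f)]%SET then 1 else -1.
exists y => [f|v]; first by rewrite /y; case: ifP; rewrite ?sqrrN expr1n.
rewrite big_imset /=; last exact: cycle_edge_inj.
have edge_sum i : i \in c -> y [set i; next c i]%SET * edge_column [set i; next c i]%SET v =
    (v == i)%:R - (v == next c i)%:R.
  move=> ic; have [nexti nexti2] := next_next_neq Uc c_gt2 ic.
  have ini : i != next c i by rewrite eq_sym.
  rewrite edge_column_ends// mulrA; set s := (X in X * _).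
  suff -> : s = 1 by rewrite mul1r.
  rewrite {}/s /y; have := @orientation [set i; next c i]%SET.
  rewrite /is_edge cards2 ini eqxx => /(_ isT).
  rewrite !inE; set a := o _ => /orP[]/eqP ->.
    by rewrite !eqxx mulr1.
  rewrite (negPf nexti); case: eqP => [/setP/(_ i)|]; last by rewrite mulrNN mulr1.
  by rewrite !inE eqxx (negPf ini) eq_sym (negPf nexti2).
rewrite (eq_bigr _ edge_sum) sumrB.
rewrite [X in X - _](reindex_inj (can_inj (prev_next Uc)))/=.
by under eq_bigl do rewrite mem_next; rewrite subrr.
Qed.

Lemma sum_edge_column (S : pred 'I_n) (i j : 'I_n) : i != j ->
  \sum_(v | S v) edge_column [set i; j]%SET v =
    (if o [set i; j]%SET == i then 1 else -1) * ((S i)%:R - (S j)%:R).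
Proof.
move=> ij; have sum1 k : \sum_(v | S v) (v == k)%:R = (S k)%:R :> R.
  rewrite big_mkcond (bigD1 k)//= eqxx big1 ?addr0 => [|v /negPf ->].
    by case: (S k).
  by case: ifP.
under eq_bigr do rewrite edge_column_ends//.
by rewrite -mulr_sumr sumrB !sum1.
Qed.

(** Removing an edge [f] of a forest separates its ends.  Summing a dependency
    over the vertices on one side of this cut kills every column but that of
    [f], so the coefficient of [f] vanishes. *)
Lemma forest_columns_independent T (x : {set 'I_n} -> R) :
  is_graph T -> (forall C, ~ cycle_in T C) ->
  (forall v, \sum_(f in T) x f * edge_column f v = 0) ->
  forall f, f \in T -> x f = 0.
Proof.
move=> graphT acyc x0 f fT.
have /cards2P[i [j [ij Ef]]] := graphT f fT.
have bridge := forest_edge_is_bridge acyc ij; rewrite -Ef in bridge.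
pose S : pred 'I_n := connect (adj (T :\ f)%SET) i.
have : \sum_(v | S v) \sum_(g in T) x g * edge_column g v = 0.
  by apply: big1 => v _; exact: x0.
rewrite exchange_big/= (bigD1 f)//= [X in _ + X]big1 => [|g /andP[gT gf]].
  rewrite addr0 -mulr_sumr Ef sum_edge_column// -Ef.
  have -> : S i by exact: connect0.
  rewrite /S (negPf (bridge fT)) subr0 mulr1 => /eqP.
  by rewrite mulf_eq0; case: ifP => _; rewrite ?oppr_eq0 oner_eq0 orbF => /eqP.
have /cards2P[a [b [ab Eg]]] := graphT g gT.
rewrite -mulr_sumr Eg sum_edge_column//.
have adj_ab : connect (adj (T :\ f)%SET) a b.
  by apply: connect1; rewrite /adj /= -Eg !inE gf gT.
have -> : S a = S b.
  by rewrite /S; apply: same_connect_r => //; exact/sym_connect_sym/adj_sym.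
by rewrite subrr !mulr0.
Qed.

(** Solving the dependency around the cycle for the column of the chord: its
    coordinates on the tree edges are signs on the cycle and 0 elsewhere. *)
Lemma chord_column_coordinates T C e :
  (forall C, ~ cycle_in T C) -> e \notin T -> cycle_in (e |: T)%SET C ->
  exists2 x : {set 'I_n} -> R, (forall f, x f ^+ 2 = (f \in C)%:R) &
    forall v, edge_column e v = \sum_(f in T) x f * edge_column f v.
Proof.
move=> acyc eT CeT; have EC := chord_in_cycle acyc CeT.
have [y y2 y0] := cycle_dependency CeT.1.
exists (fun f => if f \in C then - y e * y f else 0) => [f|v].
  by case: ifP => _; rewrite ?expr0n// exprMn sqrrN !y2 mulr1.
have /eqP : \sum_(f in (e |: T :&: C)%SET) y f * edge_column f v = 0 by rewrite -EC y0.
rewrite big_setU1/=; last by rewrite inE (negPf eT).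
rewrite addr_eq0 => /eqP yv.
rewrite -[LHS]mul1r -(y2 e) expr2 -mulrA yv mulrN -mulNr mulr_sumr.
rewrite [RHS](bigID (mem C))/= [X in _ = _ + X]big1 => [|f /andP[_ fC]].
  rewrite addr0; apply: eq_big => f; rewrite finset.in_setI// => /andP[_ ->].
  by rewrite mulrA.
by rewrite (negPf fC) mul0r.
Qed.

(** The coordinates of the chord are unique by independence, and a cycle can be
    read off from where they do not vanish. *)
Lemma chord_cycle_unique T C C' e :
  is_graph T -> (forall C, ~ cycle_in T C) -> e \notin T ->
  cycle_in (e |: T)%SET C -> cycle_in (e |: T)%SET C' -> C = C'.
Proof.
move=> graphT acyc eT CeT CeT'.
have [x x2 xe] := chord_column_coordinates acyc eT CeT.
have [x' x2' xe'] := chord_column_coordinates acyc eT CeT'.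
have xx' f : f \in T -> x f - x' f = 0.
  apply: (forest_columns_independent (x := fun f => x f - x' f)) => // v.
  under eq_bigr do rewrite mulrBl.
  by rewrite sumrB -xe -xe' subrr.
rewrite (chord_in_cycle acyc CeT) (chord_in_cycle acyc CeT').
congr (e |: _)%SET; apply/setP => f; rewrite !inE.
have [fT|//] := boolP (f \in T).
have := x2 f; rewrite (subr0_eq (xx' f fT)) x2' => /eqP.
by rewrite eqr_nat; case: (f \in C); case: (f \in C').
Qed.

End IncidenceColumns.

(** * The H2 norm of edge consensus *)

Section EdgeConsensusH2.
Variables (R : realType) (n : nat) (T : {set {set 'I_n}}).
Variables (o : {set 'I_n} -> 'I_n) (w : {set 'I_n} -> R) (eps : 'I_n -> R).
Variables (sw sv : R).
Hypotheses (w_gt0 : forall f, f \in T -> 0 < w f)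
  (eps_gt0 : forall i, 0 < eps i) (sw_gt0 : 0 < sw)
  (D_inj : forall v : 'rV[R]_#|T|, v *m (incidence R o T)^T = 0 -> v = 0).

Local Notation D := (incidence R o T).
Local Notation L := (edge_laplacian o eps T).

(** The rows of [R_mx R o T G] describe the fundamental cuts of the spanning tree
    [T], and this is their Gram matrix for the edge weights; it governs the
    dynamics through [A = - L *m M]. *)
Definition cut_gram_mx (G : {set {set 'I_n}}) : 'M[R]_#|T| :=
  R_mx R o T G *m W_mx w T G *m (R_mx R o T G)^T.

Lemma invmx_timescale :
  invmx (timescale_mx eps) = diag_mx (\row_i (eps i)^-1).
Proof.
rewrite invmx_diag => [|i]; last by rewrite mxE gt_eqF.
by congr diag_mx; apply/rowP => i; rewrite !mxE.
Qed.

Lemma edge_laplacian_sym : L^T = L.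
Proof.
by rewrite /edge_laplacian invmx_timescale !trmx_mul trmxK tr_diag_mx mulmxA.
Qed.

Lemma edge_laplacian_coercive : exists2 c : R, 0 < c &
  forall v : 'rV_#|T|, c * (v *m v^T) 0 0 <= (v *m L *m v^T) 0 0.
Proof.
rewrite /edge_laplacian invmx_timescale; apply: weighted_gram_coercive => // i.
by rewrite mxE invr_gt0.
Qed.

Lemma cut_gram_sym G : (cut_gram_mx G)^T = cut_gram_mx G.
Proof. by rewrite !trmx_mul trmxK tr_diag_mx mulmxA. Qed.

Lemma cut_gram_coercive G : (forall f, f \in (G :\: T)%SET -> 0 < w f) ->
  exists2 c : R, 0 < c & forall v : 'rV_#|T|,
    c * (v *m v^T) 0 0 <= (v *m cut_gram_mx G *m v^T) 0 0.
Proof.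
move=> wG; rewrite /cut_gram_mx -{1}[R_mx R o T G]trmxK.
apply: weighted_gram_coercive => [v|i].
  rewrite trmxK /R_mx mul_mx_row mulmx1 => /(congr1 lsubmx).
  by rewrite row_mxKl linear0.
rewrite /graph_weight_row mxE; case: splitP => j _; rewrite mxE.
  exact/w_gt0/enum_valP.
exact/wG/enum_valP.
Qed.

(** With [L] the edge Laplacian and [M] the cut Gram matrix, [A = - L M] and
    [B B^T = sw^2 L + sv^2 L M L], for which [(sw^2 M^-1 + sv^2 L) / 2] solves
    the Lyapunov equation. *)
Lemma H2sq_edge_consensus G : (forall f, f \in (G :\: T)%SET -> 0 < w f) ->
  H2sq (edge_consensus o w eps sw sv T G) =
  (sw ^+ 2 / 2 * \tr (invmx (cut_gram_mx G)) + sv ^+ 2 / 2 * \tr L)%:E.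
Proof.
move=> wG; set S := edge_consensus _ _ _ _ _ _ _.
have [cM cM0 leM] := cut_gram_coercive wG.
have [cL cL0 leL] := edge_laplacian_coercive.
have Mu := coercive_unitmx cM0 leM.
set M := cut_gram_mx G in leM Mu *.
have M_ge0 (v : 'rV_#|T|) : 0 <= (v *m M *m v^T) 0 0.
  by apply: le_trans _ (leM v); rewrite mulr_ge0 ?sqnorm_ge0 ?ltW.
have L_ge0 (v : 'rV_#|T|) : 0 <= (v *m L *m v^T) 0 0.
  by apply: le_trans _ (leL v); rewrite mulr_ge0 ?sqnorm_ge0 ?ltW.
have EA : ltiA S = - (L *m M) by rewrite /M /cut_gram_mx !mulmxA.
have W_sqrt2 : W_sqrt_mx w T G *m (W_sqrt_mx w T G)^T = W_mx w T G.
  rewrite tr_diag_mx mulmx_diag; congr diag_mx.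
  apply/rowP => i; rewrite !mxE -expr2 sqr_sqrtr//.
  case: splitP => j _; rewrite mxE ltW//; first exact/w_gt0/enum_valP.
  exact/wG/enum_valP.
have EB : ltiB S *m (ltiB S)^T = sw ^+ 2 *: L + sv ^+ 2 *: (L *m M *m L).
  rewrite /= tr_row_mx mul_row_col; congr (_ + _).
    rewrite /Omega_mx -scalemxAr linearZ/= -scalemxAl -scalemxAr scalerA -expr2.
    congr (_ *: _); rewrite invmx_timescale /timescale_sqrt_mx !trmx_mul trmxK.
    rewrite !tr_diag_mx /edge_laplacian invmx_timescale !mulmxA; congr (_ *m _).
    rewrite -!mulmxA; congr (_ *m _); rewrite !mulmx_diag; congr diag_mx.
    apply/rowP => i; rewrite !mxE.
    have := sqr_sqrtr (ltW (eps_gt0 i)); have := lt0r_neq0 (eps_gt0 i).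
    by move: (Num.sqrt _) => s /[swap] <-; rewrite expf_eq0/= => s0; field.
  rewrite linearN mulmxN mulNmx opprK.
  rewrite /Gamma_mx -scalemxAr linearZ/= -scalemxAl -scalemxAr scalerA -expr2.
  congr (_ *: _); rewrite 2!trmx_mul edge_laplacian_sym mulmxA.
  rewrite -(mulmxA _ (W_sqrt_mx _ _ _)) W_sqrt2.
  by rewrite /M /cut_gram_mx !mulmxA.
pose X : 'M[R]_#|T| := (sw ^+ 2 / 2) *: invmx M + (sv ^+ 2 / 2) *: L.
have [K K0 leK] := quad_upper_bound X.
rewrite (@H2sq_lyapunov _ _ _ _ S X (sw ^+ 2 * cL / K)) => //.
- by rewrite mul1mx trmx1 mulmx1 mxtraceD !mxtraceZ.
- rewrite EA EB linearN/= trmx_mul edge_laplacian_sym cut_gram_sym.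
  rewrite mulNmx mulmxN -opprD; congr (- _).
  rewrite /X mulmxDr mulmxDl -!scalemxAr -!scalemxAl.
  rewrite mulmxK// mulKmx// [L *m (M *m L)]mulmxA addrACA.
  by congr (_ + _); rewrite -scalerDl; congr (_ *: _); field.
- move=> v; rewrite quad_comb addr_ge0// mulr_ge0// ?divr_ge0 ?sqr_ge0//.
  have := M_ge0 (v *m invmx M).
  by rewrite mulmxKV// trmx_mul trmx_inv cut_gram_sym mulmxA.
- by rewrite divr_gt0 ?mulr_gt0 ?exprn_gt0.
(* X <= K, whereas B B^T >= sw^2 L >= sw^2 cL *)
- move=> v; rewrite EB [leRHS]quad_comb.
  apply: (@le_trans _ _ (sw ^+ 2 * (v *m L *m v^T) 0 0)).
    rewrite -2!(mulrA (sw ^+ 2)) ler_pM2l ?exprn_gt0//; apply: le_trans _ (leL v).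
    by rewrite -mulrA ler_pM2l// ler_pdivrMl.
  rewrite lerDl mulr_ge0 ?sqr_ge0//.
  have := M_ge0 (v *m L).
  by rewrite trmx_mul edge_laplacian_sym !mulmxA.
Qed.

(** Each non-tree edge updates the diagonal matrix of the tree weights by a
    matrix of rank one, built on its least-squares coordinates in the tree
    columns. *)
Lemma cut_gramE G :
  let z f := invmx (D^T *m D) *m D^T *m (\col_i edge_column R o f i) in
  cut_gram_mx G = diag_mx (weight_row w T) +
    \sum_(f in (G :\: T)%SET) w f *: (z f *m (z f)^T).
Proof.
move=> z; rewrite /cut_gram_mx /R_mx /W_mx /graph_weight_row.
rewrite diag_mx_row tr_row_mx mul_row_block !mulmx0 addr0 add0r mul1mx.
rewrite mul_row_col trmx1 mulmx1; congr (_ + _).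
rewrite big_enum_val/=.
set Z := tree_cotree_mx _ _ _ _.
have colZ a j : Z a j = z (enum_val j) a 0.
  rewrite /Z /tree_cotree_mx /z !mxE; apply: eq_bigr => k _.
  by congr (_ * _); rewrite !mxE.
apply/matrixP => a b; rewrite summxE mxE; apply: eq_bigr => j _.
rewrite mul_mx_diag mxE [Z^T _ _]mxE [weight_row _ _ _ _]mxE !colZ.
rewrite [RHS]mxE [(z _ *m _) _ _]mxE big_ord1 [(z _)^T _ _]mxE.
by ring.
Qed.

End EdgeConsensusH2.

Lemma H2sq_ge0 (R : realType) (m q l : nat) (S : lti R m q l) :
  (0 <= H2sq S)%E.
Proof.
apply: integral_ge0 => t _; rewrite lee_fin.
apply: sumr_ge0 => i _; rewrite mxE sumr_ge0// => j _.
by rewrite [X in _ * X]mxE -expr2 sqr_ge0.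
Qed.

Section TreeConsensus.
Variables (R : realType) (n : nat) (T : {set {set 'I_n}}).
Variables (o : {set 'I_n} -> 'I_n) (w : {set 'I_n} -> R) (eps : 'I_n -> R).
Variables (sw sv : R).
Hypotheses (graphT : is_graph T) (acyc : forall C, ~ cycle_in T C).
Hypothesis orientation : forall f : {set 'I_n}, is_edge f -> o f \in f.
Hypotheses (w_gt0 : forall f, f \in T -> 0 < w f)
  (eps_gt0 : forall i, 0 < eps i) (sw_gt0 : 0 < sw).

Local Notation D := (incidence R o T).

Lemma mul_incidence_col (x : {set 'I_n} -> R) :
  D *m (\col_j x (enum_val j)) = \col_i \sum_(f in T) x f * edge_column R o f i.
Proof.
apply/colP => i; rewrite !mxE [RHS]big_enum_val/=; apply: eq_bigr => j _.
by rewrite !mxE mulrC.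
Qed.

Lemma forest_incidence_inj (v : 'rV[R]_#|T|) : v *m D^T = 0 -> v = 0.
Proof.
move=> vD; have [f0 f0T|T0] := pickP (mem T); last first.
  apply/rowP => j; have := enum_valP j.
  by have := T0 (enum_val j); rewrite /= => ->.
pose x f := v 0 (enum_rank_in f0T f).
have xE j : x (enum_val j) = v 0 j by rewrite /x enum_valK_in.
have x0 f : f \in T -> x f = 0.
  apply: (forest_columns_independent orientation graphT acyc) => i.
  have := mul_incidence_col x => /colP/(_ i); rewrite [RHS]mxE => <-.
  have -> : \col_j x (enum_val j) = v^T by apply/colP => j; rewrite !mxE xE.
  by rewrite -[D]trmxK -trmx_mul vD !mxE.
by apply/rowP => j; rewrite -xE x0 ?mxE//; exact: enum_valP.
Qed.

Lemma weighted_length_chord e C : cycle_in (e |: T)%SET C -> e \notin T ->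
  weighted_length w C = (w e)^-1 + \sum_(f in (T :&: C)%SET) (w f)^-1.
Proof.
move=> CeT eT; rewrite /weighted_length {1}(chord_in_cycle acyc CeT).
by rewrite big_setU1//= inE (negPf eT).
Qed.

(** Edge-disjoint cycles have coordinate vectors with disjoint supports, which
    are orthogonal for the inverse tree weights, so that the updates of the cut
    Gram matrix do not interact.  The trace of the update of index [k] is
    the sum of [(w f) ^- 2] over the tree edges of [C k], divided by
    [(w (e k))^-1] plus the sum of [(w f)^-1] over the same edges, which is the
    weighted length. *)
Lemma H2sq_tree_with_chords (p : nat) (e : 'I_p -> {set 'I_n})
    (C : 'I_p -> {set {set 'I_n}}) :
  (forall k, e k \notin T) -> (forall k, 0 < w (e k)) ->
  (forall k, cycle_in (e k |: T)%SET (C k)) ->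
  (forall k l, k != l -> [disjoint C k & C l]) ->
  H2sq (edge_consensus o w eps sw sv T (T :|: [set e k | k : 'I_p])%SET) =
  (sw ^+ 2 / 2 * (\sum_(f in T) (w f)^-1 -
     \sum_k (weighted_length w (C k))^-1 * \sum_(f in T :&: C k) (w f) ^- 2) +
   sv ^+ 2 / 2 * \tr (edge_laplacian o eps T))%:E.
Proof.
move=> eT we CeT disjC; set G := (_ :|: _)%SET.
have EG : (G :\: T = [set e k | k : 'I_p])%SET.
  rewrite /G finset.setDUl finset.setDv finset.set0U; apply/finset.setDidPl.
  rewrite disjoint_subset; apply/fintype.subsetP => _ /imsetP[k _ ->].
  by rewrite inE eT.
rewrite (H2sq_edge_consensus sv w_gt0 eps_gt0 sw_gt0 forest_incidence_inj);
  last by move=> f; rewrite EG => /imsetP[k _ ->].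
have /fin_all_exists2[x x2 xe] k :
    exists2 x : {set 'I_n} -> R, (forall f, x f ^+ 2 = (f \in C k)%:R) &
      forall v, edge_column R o (e k) v = \sum_(f in T) x f * edge_column R o f v.
  exact: (chord_column_coordinates R orientation acyc (eT k) (CeT k)).
have e_inj : injective e.
  move=> k l ekl; apply/eqP; apply: contraT => kl.
  have := disjointFr (disjC k l kl) (_ : e k \in C k).
  rewrite (chord_in_cycle acyc (CeT k)) (chord_in_cycle acyc (CeT l)).
  by rewrite ekl !finset.setU11 => /(_ isT).
have x0 k f : f \notin C k -> x k f = 0.
  by move=> fC; apply/eqP; rewrite -sqrf_eq0 x2 (negPf fC).
pose X k : 'cV[R]_#|T| := \col_j x k (enum_val j).
pose B : 'M[R]_#|T| := diag_mx (\row_j (w (enum_val j))^-1).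
have XBX k l : (X k)^T *m B *m X l =
    (\sum_(f in T) (w f)^-1 * (x k f * x l f))%:M.
  rewrite [LHS]mx11_scalar; congr (_%:M).
  rewrite mxE [RHS]big_enum_val; apply: eq_bigr => j _.
  by rewrite mul_mx_diag !mxE; ring.
have cutE : cut_gram_mx T o w G = diag_mx (weight_row w T) +
    \sum_k w (e k) *: (X k *m (X k)^T).
  rewrite cut_gramE EG big_imset/=; last by move=> k l _ _; exact: e_inj.
  congr (_ + _); apply: eq_bigr => k _.
  suff -> : invmx (D^T *m D) *m D^T *m (\col_i edge_column R o (e k) i) = X k.
    by [].
  have -> : \col_i edge_column R o (e k) i = D *m X k.
    by rewrite mul_incidence_col; apply/colP => i; rewrite !mxE xe.
  by rewrite mulmxA -(mulmxA _ D^T) mulVmx ?mul1mx// gram_unitmx//;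
    exact: forest_incidence_inj.
have AB : diag_mx (weight_row w T) *m B = 1%:M.
  rewrite mulmx_diag -diag_const_mx; congr diag_mx; apply/rowP => j.
  by rewrite !mxE divff// gt_eqF// w_gt0// enum_valP.
have sumTC k (F : {set 'I_n} -> R) :
    \sum_(f in T) F f * x k f ^+ 2 = \sum_(f in (T :&: C k)%SET) F f.
  rewrite (bigID (mem (C k)))/= [X in _ + X]big1 => [|f /andP[_ fC]].
    rewrite addr0; apply: eq_big => f; first by rewrite inE.
    by move=> /andP[_ fC]; rewrite x2 fC mulr1.
  by rewrite x2 (negPf fC) mulr0.
have l_gt0 k : 0 < weighted_length w (C k).
  rewrite (weighted_length_chord (CeT k) (eT k)) ltr_pwDl ?invr_gt0//.
  by apply: sumr_ge0 => f /finset.setIP[fT _]; rewrite invr_ge0 ltW// w_gt0.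
rewrite cutE (invmx_rank_one_updates (l := fun k => weighted_length w (C k)) AB);
  first last.
- move=> k; rewrite (weighted_length_chord (CeT k) (eT k)) XBX mxE/= mulr1n.
  by congr (_ + _); rewrite -sumTC; apply: eq_bigr => f _; rewrite expr2.
- by move=> k; rewrite gt_eqF.
- by move=> k; rewrite gt_eqF.
- move=> k l kl; rewrite XBX big1 ?scalemx0 => [|f _].
    by apply/matrixP => i j; rewrite !mxE mul0rn.
  have [fC|fC] := boolP (f \in C k); last by rewrite x0// mul0r mulr0.
  by rewrite (x0 l) ?(disjointFr (disjC k l kl) fC)// !mulr0.
congr (_ * _ + _)%:E; rewrite raddfB/=; congr (_ - _).
  by rewrite mxtrace_diag [RHS]big_enum_val; apply: eq_bigr => j _; rewrite mxE.
rewrite raddf_sum/=; apply: eq_bigr => k _; rewrite mxtraceZ; congr (_ * _).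
rewrite -sumTC [RHS]big_enum_val; apply: eq_bigr => j _.
have -> : B *m X k *m (X k)^T *m B = B *m (X k *m (X k)^T) *m B.
  by rewrite mulmxA.
rewrite mul_mx_diag mxE mul_diag_mx !mxE big_ord1 !mxE.
by rewrite -exprVn; ring.
Qed.

End TreeConsensus.

Theorem proposition4 (R : realType) (n : nat)
    (T : {set {set 'I_n}})
    (o : {set 'I_n} -> 'I_n) (w : {set 'I_n} -> R) (eps : 'I_n -> R)
    (sw sv : R)
    (n_gt0 : (0 < n)%N)
    (treeT : is_tree T)
    (orientation : forall f : {set 'I_n}, is_edge f -> o f \in f)
    (w_gt0 : forall f : {set 'I_n}, f \in T -> 0 < w f)
    (eps_gt0 : forall i : 'I_n, 0 < eps i)
    (sw_gt0 : 0 < sw) (sv_gt0 : 0 < sv) :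
  let Sigma (G : {set {set 'I_n}}) := edge_consensus o w eps sw sv T G in
  (forall e : {set 'I_n}, is_edge e -> e \notin T -> 0 < w e ->
    (exists C : {set {set 'I_n}},
      unique (cycle_in (e |: T)%SET) C /\
      (H2sq (Sigma (e |: T)%SET) =
        H2sq (Sigma T) -
        (sw ^+ 2 / (2 * weighted_length w C) *
          \sum_(f in (T :&: C)%SET) (w f) ^- 2)%:E)%E) /\
    (H2norm (Sigma (e |: T)%SET) < H2norm (Sigma T))%E) /\
  (forall (p : nat) (e : 'I_p -> {set 'I_n}) (C : 'I_p -> {set {set 'I_n}}),
    (forall k : 'I_p, [/\ is_edge (e k), e k \notin T & 0 < w (e k)]) ->
    (forall k : 'I_p, cycle_in (e k |: T)%SET (C k)) ->
    (forall k l : 'I_p, k != l -> [disjoint C k & C l]) ->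
    (H2sq (Sigma (T :|: [set e k | k : 'I_p])%SET) =
      H2sq (Sigma T) -
      (\sum_(k < p) (sw ^+ 2 / (2 * weighted_length w (C k)) *
         \sum_(f in (T :&: C k)%SET) (w f) ^- 2))%:E)%E).
Proof.
move=> Sigma; have [graphT connT acyc] := treeT.
have H2sq_chords := H2sq_tree_with_chords sv graphT acyc orientation w_gt0
  eps_gt0 sw_gt0.
(* the tree itself is the case of no added edge *)
have H2sq_T : H2sq (Sigma T) = (sw ^+ 2 / 2 * \sum_(f in T) (w f)^-1 +
    sv ^+ 2 / 2 * \tr (edge_laplacian o eps T))%:E.
  have no_chord (A : Type) (k : 'I_0) : A by case: k.
  have := H2sq_chords 0%N (fun=> finset.set0) (fun=> finset.set0).
  rewrite big_ord0 subr0.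
  have -> : [set finset.set0 | k : 'I_0]%SET = finset.set0 :> {set {set 'I_n}}.
    by apply/setP => f; rewrite inE; apply/imsetP => -[k]; exact: no_chord.
  by rewrite finset.setU0; apply => k; exact: no_chord.
have part2 (p : nat) (e : 'I_p -> {set 'I_n}) (C : 'I_p -> {set {set 'I_n}}) :
    (forall k : 'I_p, [/\ is_edge (e k), e k \notin T & 0 < w (e k)]) ->
    (forall k : 'I_p, cycle_in (e k |: T)%SET (C k)) ->
    (forall k l : 'I_p, k != l -> [disjoint C k & C l]) ->
    (H2sq (Sigma (T :|: [set e k | k : 'I_p])%SET) =
      H2sq (Sigma T) -
      (\sum_(k < p) (sw ^+ 2 / (2 * weighted_length w (C k)) *
         \sum_(f in (T :&: C k)%SET) (w f) ^- 2))%:E)%E.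
  move=> he CeT disjC; rewrite (H2sq_chords p e C)//; try by move=> k; case: (he k).
  rewrite H2sq_T -EFinB; congr _%:E.
  rewrite mulrBr addrAC; congr (_ + _ - _).
  rewrite mulr_sumr; apply: eq_bigr => k _; rewrite invfM; ring.
split; last exact: part2.
move=> e edge_e eT we.
have /cards2P[i [j [ij Ee]]] := edge_e.
have [C CeT] : exists C, cycle_in (e |: T)%SET C.
  by rewrite Ee; apply: path_closes_to_cycle => //; rewrite -Ee.
have decrease : H2sq (Sigma (e |: T)%SET) = (H2sq (Sigma T) -
    (sw ^+ 2 / (2 * weighted_length w C) *
       \sum_(f in (T :&: C)%SET) (w f) ^- 2)%:E)%E.
  have := part2 1%N (fun=> e) (fun=> C); rewrite big_ord1.
  have -> : [set e | k : 'I_1]%SET = [set e]%SET.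
    apply/setP => f; rewrite inE; apply/imsetP/eqP => [[]//|->].
    by exists ord0.
  rewrite [(T :|: _)%SET]finset.setUC; apply => // k l.
  by rewrite (ord1 k) (ord1 l) eqxx.
split.
  exists C; split=> //; split=> // C'.
  exact: (chord_cycle_unique R orientation graphT acyc eT CeT).
have TC_gt0 f : f \in (T :&: C)%SET -> 0 < w f.
  by move=> /finset.setIP[fT _]; exact: w_gt0.
have l_gt0 : 0 < weighted_length w C.
  rewrite (weighted_length_chord w acyc CeT eT) ltr_pwDl ?invr_gt0//.
  by apply: sumr_ge0 => f /TC_gt0 wf; rewrite invr_ge0 ltW.
have [f fTC] : exists f, f \in (T :&: C)%SET.
  apply/set0Pn/eqP => TC0; have := card_cycle CeT.1.
  by rewrite (chord_in_cycle acyc CeT) TC0 finset.setU0 cards1.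
have drop_gt0 : 0 < \sum_(f in (T :&: C)%SET) (w f) ^- 2.
  rewrite (bigD1 f)//= ltr_pwDl ?invr_gt0 ?exprn_gt0 ?TC_gt0//.
  by apply: sumr_ge0 => g /andP[/TC_gt0 wg _]; rewrite invr_ge0 exprn_ge0 ?ltW.
have := H2sq_ge0 (Sigma (e |: T)%SET); have := H2sq_ge0 (Sigma T).
rewrite /H2norm decrease H2sq_T -EFinB !poweR_EFin !lee_fin lte_fin => T0 eT0.
apply: gt0_ltr_powR; rewrite ?invr_gt0// ltrBlDr ltrDl.
by rewrite mulr_gt0// divr_gt0 ?exprn_gt0 ?mulr_gt0.
Qed.
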